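(* Let $G$ be a connected weighted graph of order $n\ge2$, let $M=D^{-1/2}AD^{-1/2}$ be its normalized adjacency matrix, with eigenvalues $1=\lambda_1>\lambda_2\ge\cdots\ge\lambda_n\ge-1$, and let $B$ be an $m\times m$ matrix with eigenvalues $\theta_1\ge\cdots\ge\theta_m$ such that $B$ is either (i) a principal submatrix of $M$, or (ii) the quotient matrix of $M$ with respect to a partition $\{V_1,\dots,V_m\}$ of the vertex set of $G$ into nonempty parts. Then $$\sum_{i=2}^{m}\frac{1}{1-\theta_i}+\frac{n-m}{2}\ \le\ K(G)\ \le\ \sum_{i=2}^{m}\frac{1}{1-\theta_i}+\frac{n-m}{1-\lambda_2}.$$
   Context: Graphs are finite, simple, connected, undirected and weighted: $G=(V,E,c)$ with symmetric weights $c(i,j)=c_{ij}=c_{ji}>0$ if $\{i,j\}\in E$ and $c_{ij}=0$ otherwise (no loops), $|V|=n$. The degree of vertex $i$ is $k_i=\sum_j c_{ij}$, $D=\operatorname{diag}(k_1,\dots,k_n)$, $A=(c_{ij})$ is the adjacency matrix. The quotient matrix of a symmetric matrix $N$ (rows and columns indexed by $V$) with respect to a partition $\{V_1,\dots,V_m\}$ of $V$ is the $m\times m$ matrix whose $(i,j)$ entry is the average row sum of the block of $N$ with rows in $V_i$ and columns in $V_j$, i.e. $\frac{1}{|V_i|}\sum_{u\in V_i,v\in V_j}N_{uv}$. (Its eigenvalues are real.) Kemeny's constant is $K(G)=\sum_i\pi_i m_{ji}-1$ for the random walk with transition matrix $D^{-1}A$, where $\pi$ is the stationary distribution and $m_{ji}$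 the mean first passage time from $j$ to $i$ (with $m_{jj}$ the mean first return time); this does not depend on $j$, and it is known that $K(G)=\sum_{j=2}^{n}\frac{1}{1-\lambda_j}$. *)

(* Defs.v *)
From HB Require Import structures.
From mathcomp Require Import all_boot all_order all_algebra.
From mathcomp Require Import all_classical all_reals all_analysis.
Set Implicit Arguments.
Unset Strict Implicit.
Unset Printing Implicit Defensive.
Import Order.TTheory GRing.Theory Num.Theory.
Local Open Scope ring_scope.

Section WeightedGraph.
Variables (R : realType) (n : nat).
Implicit Type c : 'M[R]_n.

(* A weighted graph on the vertex set 'I_n is given by its weighted adjacency
   matrix c; {i, j} is an edge iff 0 < c i j. *)
Definition adjacent c : rel 'I_n := [rel i j | 0 < c i j].

Definition is_weighted_graph c : Prop :=
  [/\ forall i j, c i j = c j i,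
      forall i j, 0 <= c i j,
      forall i, c i i = 0
    & forall i j, connect (adjacent c) i j].

Definition degree c (i : 'I_n) : R := \sum_j c i j.

Definition degree_mx c : 'M[R]_n := diag_mx (\row_i degree c i).

Definition degree_mx_invsqrt c : 'M[R]_n :=
  diag_mx (\row_i (Num.sqrt (degree c i))^-1).

Definition normalized_adjacency c : 'M[R]_n :=
  degree_mx_invsqrt c *m c *m degree_mx_invsqrt c.

Definition transition_mx c : 'M[R]_n := invmx (degree_mx c) *m c.

End WeightedGraph.

Section Eigenvalues.
Variables (R : realType) (m : nat).

(* s lists the eigenvalues of N with algebraic multiplicity, largest first;
   the i-th eigenvalue (counting from 1) is s`_i.-1. *)
Definition eigenvalues_of (N : 'M[R]_m) (s : m.-tuple R) : Prop :=
  sorted >=%R s /\ char_poly N = \prod_(x <- s) ('X - x%:P).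

End Eigenvalues.

Section Submatrices.
Variables (R : realType) (n m : nat).

Definition is_principal_submx (N : 'M[R]_n) (B : 'M[R]_m) : Prop :=
  exists2 f : 'I_m -> 'I_n, injective f & B = mxsub f f N.

Definition is_indexed_partition (W : 'I_m -> {set 'I_n}) : Prop :=
  injective W /\ finset.partition [set W i | i : 'I_m]%SET [set: 'I_n]%SET.

Definition quotient_mx (N : 'M[R]_n) (W : 'I_m -> {set 'I_n}) : 'M[R]_m :=
  \matrix_(i, j) (#|W i|%:R^-1 * \sum_(u in W i) \sum_(v in W j) N u v).

End Submatrices.

Section MarkovChain.
Variables (R : realType) (n : nat) (P : 'M[R]_n).

Definition is_stationary (p : 'rV[R]_n) : Prop :=
  [/\ forall i, 0 <= p 0 i, \sum_i p 0 i = 1 & p *m P = p].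

(* Probability that (X_1, X_2, ...) starts with w, given X_0 = j. *)
Fixpoint walk_prob (j : 'I_n) (w : seq 'I_n) : R :=
  if w is k :: w' then P j k * walk_prob k w' else 1.

(* Probability, given X_0 = j, that min {t >= 1 : X_t = i} equals t: the sum is
   over the values w of (X_1, ..., X_t) whose first occurrence of i is the last
   entry.  It is 0 for t = 0, and j = i gives the first return time. *)
Definition first_passage_prob (j i : 'I_n) (t : nat) : R :=
  \sum_(w : t.-tuple 'I_n | (index i w).+1 == t) walk_prob j w.

(* The expectation of the first passage time (a.s. finite when the chain is
   irreducible). *)
Definition mean_first_passage_time (j i : 'I_n) : \bar R :=
  (\sum_(0 <= t <oo) (t%:R * first_passage_prob j i t)%:E)%E.

Definition kemeny (p : 'rV[R]_n) (j : 'I_n) : \bar R :=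
  (\sum_i (p 0 i)%:E * mean_first_passage_time j i - 1)%E.

End MarkovChain.

(* Main.v *)
Require Import Defs.
From HB Require Import structures.
From mathcomp Require Import all_boot all_order all_algebra.
From mathcomp Require Import all_classical all_reals all_analysis.
From mathcomp Require Import ring lra zify.
Set Implicit Arguments.
Unset Strict Implicit.
Unset Printing Implicit Defensive.
Import Order.TTheory GRing.Theory Num.Theory.
Import numFieldNormedType.Exports.
Local Open Scope ring_scope.

(* Up to similarity, a principal submatrix or a quotient matrix of M is a
   compression S M S^T with S S^T = 1, so Cauchy interlacing gives
   lambda_(n-m+i) <= theta_i <= lambda_i.  As K(G) is the sum of the
   1/(1 - lambda_i) for i >= 2 and x |-> 1/(1 - x) is increasing on [-1, 1[,
   comparing the sums term by term, with -1 <= lambda_i <= lambda_2 for the n-m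
   unmatched terms, yields both bounds.

   For the formula for K(G), write Y_ji = pi_i m_ji - [j = i].  First-step
   analysis gives (I - P) Y = 1 pi - I; moreover Y has zero diagonal and all its
   row sums are K(G).  In an orthonormal eigenbasis of M, the conjugate
   D^(1/2) Y D^(-1/2) has diagonal entries -1/(1 - lambda_i) for i >= 2 and K(G)
   for i = 1, while its trace is 0. *)

(** * Spectral theorem for symmetric matrices, and Cauchy interlacing *)

Section Spectral.
Variable R : rcfType.

Lemma char_poly_conj (F : comUnitRingType) n (P A Q : 'M[F]_n) :
  P *m Q = 1%:M -> char_poly (P *m A *m Q) = char_poly A.
Proof.
move=> PQ1; rewrite /char_poly /char_poly_mx !map_mxM/=.
have PQ1' : map_mx (@polyC F) P *m map_mx (@polyC F) Q = 1%:M.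
  by rewrite -map_mxM PQ1 map_mx1.
have -> : 'X%:M - map_mx (@polyC F) P *m map_mx (@polyC F) A *m map_mx (@polyC F) Q
   = map_mx (@polyC F) P *m ('X%:M - map_mx (@polyC F) A) *m map_mx (@polyC F) Q.
  by rewrite mulmxBr mulmxBl scalar_mxC -(mulmxA 'X%:M) PQ1' mulmx1.
by rewrite !det_mulmx mulrAC -det_mulmx PQ1' det1 mul1r.
Qed.

Lemma char_poly_block_diag (F : comNzRingType) n1 n2 (A : 'M[F]_n1) (B : 'M[F]_n2) :
  char_poly (block_mx A 0 0 B) = char_poly A * char_poly B.
Proof. by rewrite /char_poly char_block_diag_mx det_ublock. Qed.

Lemma dot_ge0 n (u : 'rV[R]_n) : 0 <= (u *m u^T) 0 0.
Proof. by rewrite mxE sumr_ge0// => i _; rewrite mxE -expr2 sqr_ge0. Qed.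

Lemma dot_eq0 n (u : 'rV[R]_n) : ((u *m u^T) 0 0 == 0) = (u == 0).
Proof.
apply/eqP/eqP => [|->]; last by rewrite mul0mx mxE.
rewrite mxE => /eqP; rewrite psumr_eq0 => [/allP u0|i _]; last first.
  by rewrite mxE -expr2 sqr_ge0.
apply/rowP => i; have := u0 i (mem_index_enum i).
by rewrite /= [X in _ * X]mxE -expr2 sqrf_eq0 [RHS]mxE => /eqP.
Qed.

(* The Householder reflection exchanging the two vectors. *)
Lemma orthogonal_map n (e v : 'rV[R]_n) : e *m e^T = 1%:M -> v *m v^T = 1%:M ->
  exists H, H *m H^T = 1%:M /\ e *m H = v.
Proof.
move=> ee vv; have [->|ev] := eqVneq e v.
  by exists 1%:M; rewrite trmx1 !mulmx1.
have [w wE] : exists w, w = e - v by exists (e - v).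
pose s := (w *m w^T) 0 0.
have s0 : s != 0 by rewrite dot_eq0 wE subr_eq0.
have ww : w *m w^T = s%:M by rewrite [LHS]mx11_scalar.
pose b := (e *m v^T) 0 0.
have evT : e *m v^T = b%:M by rewrite [LHS]mx11_scalar.
have veT : v *m e^T = b%:M by rewrite -[v]trmxK -trmx_mul evT tr_scalar_mx.
have ew : e *m w^T = (1 - b)%:M.
  by rewrite wE linearB/= mulmxBr ee evT raddfB.
(* This makes the coefficient of [w] in the image of [e] equal to 1, so that [e] is sent to
   [e - w = v]. *)
have sE : s = 2 * (1 - b).
  rewrite /s {1}wE mulmxBl ew wE linearB/= mulmxBr vv veT -raddfB -raddfB mxE/= mulr1n.
  by ring.
exists (1%:M - (2 / s) *: (w^T *m w)); split.
- have -> : (1%:M - (2 / s) *: (w^T *m w))^T = 1%:M - (2 / s) *: (w^T *m w).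
    by rewrite linearB linearZ/= trmx1 trmx_mul trmxK.
  rewrite mulmxBl mul1mx mulmxBr mulmx1.
  rewrite -scalemxAl -scalemxAr -mulmxA (mulmxA w) ww mul_scalar_mx -scalemxAr !scalerA.
  rewrite divfK// mulr_natr mulr2n scalerDl.
  by rewrite opprB addrK subrK.
- rewrite mulmxBr mulmx1 -scalemxAr mulmxA ew mul_scalar_mx scalerA.
  rewrite mulrAC -sE divff// scale1r wE opprB addrC subrK//.
Qed.

(** Induction on [n]. A unit eigenvector for the head of [s] is moved to the first basis vector by
    an orthogonal [H]; the conjugate of [N] then splits off a 1 by 1 block, and the induction
    hypothesis handles the other block. The order of [s] is kept on the diagonal, as interlacing
    requires. *)
Lemma sym_spectral n (N : 'M[R]_n) (s : seq R) : N^T = N -> size s = n ->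
    char_poly N = \prod_(x <- s) ('X - x%:P) ->
  exists Q : 'M[R]_n, Q *m Q^T = 1%:M /\ N = Q^T *m diag_mx (\row_i s`_i) *m Q.
Proof.
elim: n N s => [|n IHn] N s symN.
  by move=> _ _; exists (1%:M : 'M[R]_0); split; apply/matrixP => -[].
case: s => // x s [ss] chN.
have : eigenvalue N x.
  by rewrite eigenvalue_root_char chN big_cons rootM root_XsubC eqxx.
move=> /eigenvalueP[v0 v0N v00].
set d := (v0 *m v0^T) 0 0.
have d0 : 0 < d by rewrite lt_def dot_eq0 v00 dot_ge0.
pose v := (Num.sqrt d)^-1 *: v0.
have vN : v *m N = x *: v by rewrite -scalemxAl v0N scalerA mulrC -scalerA.
have vv : v *m v^T = 1%:M.
  rewrite linearZ/= -scalemxAl -scalemxAr scalerA [v0 *m _]mx11_scalar -/d.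
  by rewrite scale_scalar_mx -expr2 exprVn sqr_sqrtr ?ltW// mulVf// gt_eqF.
pose e : 'rV[R]_(1 + n) := delta_mx 0 0.
have ee : e *m e^T = 1%:M.
  by rewrite trmx_delta mul_delta_mx; apply/matrixP => i j; rewrite !mxE !ord1.
have [H [HH eH]] := orthogonal_map ee vv.
have HH' : H^T *m H = 1%:M by apply: mulmx1C.
pose N1 : 'M[R]_(1 + n) := H *m N *m H^T.
have symN1 : N1^T = N1 by rewrite /N1 !trmx_mul trmxK symN mulmxA.
have eN1 : e *m N1 = x *: e.
  by rewrite /N1 !mulmxA eH vN -scalemxAl -eH -mulmxA HH mulmx1.
have eE : e = row_mx 1%:M 0.
  apply/rowP => j; rewrite !mxE; case: splitP => k kj; rewrite !mxE ?ord1//=.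
    by rewrite (_ : j = 0) ?eqxx//; apply: val_inj; rewrite /= kj ord1.
  by rewrite -val_eqE/= kj.
have : e *m N1 = row_mx (ulsubmx N1) (ursubmx N1).
  by rewrite -[in LHS](submxK N1) eE mul_row_block !mul1mx !mul0mx !addr0.
rewrite eN1 eE scale_row_mx scaler0 scalemx1 => /eq_row_mx[/esym ul /esym ur].
(* The first row of [N1] is [x *: e]; by symmetry so is its first column. *)
have dl : dlsubmx N1 = 0 by rewrite -[N1]symN1 -trmx_ursub ur trmx0.
have N1E : N1 = block_mx x%:M 0 0 (drsubmx N1).
  by rewrite -[LHS]submxK ul ur dl.
have [||Q [QQ N2E]] := IHn (drsubmx N1) s _ ss.
- by rewrite trmx_drsub symN1.
(* Cancelling the factor ['X - x%:P] leaves the characteristic polynomial of the lower block. *)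
- have := char_poly_conj N HH; rewrite -/N1 {1}N1E chN big_cons.
  rewrite (char_poly_block_diag (x%:M : 'M[R]_1)) {1}/char_poly det_mx11 !mxE/=.
  by move=> /mulfI -> //; rewrite polyXsubC_eq0.
pose Q1 : 'M[R]_(1 + n) := block_mx 1%:M 0 0 Q.
have QQ1 : Q1 *m Q1^T = 1%:M.
  rewrite /Q1 tr_block_mx !trmx0 trmx1 mulmx_block !mul0mx !mulmx0 !addr0 !add0r.
  by rewrite mul1mx QQ -scalar_mx_block.
have N1Q : N1 = Q1^T *m diag_mx (\row_i (x :: s)`_i) *m Q1.
  have -> : \row_(i < 1 + n) (x :: s)`_i = row_mx x%:M (\row_i s`_i).
    apply/rowP => i; rewrite !mxE; case: splitP => k ->; rewrite !mxE//.
    by rewrite !ord1.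
  rewrite diag_mx_row N1E /Q1 tr_block_mx !trmx0 trmx1 !mulmx_block.
  rewrite !mul0mx !mulmx0 !addr0 !add0r mul1mx mulmx1 N2E mul0mx; congr block_mx.
    by apply/matrixP => i j; rewrite !ord1 !mxE.
  by rewrite mul0mx.
exists (Q1 *m H); split.
  by rewrite trmx_mul mulmxA -(mulmxA Q1) HH mulmx1.
have -> : N = H^T *m N1 *m H.
  by rewrite /N1 !mulmxA HH' mul1mx -mulmxA HH' mulmx1.
by rewrite trmx_mul N1Q !mulmxA.
Qed.

Lemma quad_diag n (f : 'I_n -> R) (y : 'rV[R]_n) :
  (y *m diag_mx (\row_i f i) *m y^T) 0 0 = \sum_i f i * y 0 i ^+ 2.
Proof. by rewrite mxE; apply: eq_bigr => i _; rewrite mul_mx_diag !mxE; ring. Qed.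

Lemma dot_sum n (y : 'rV[R]_n) : (y *m y^T) 0 0 = \sum_i y 0 i ^+ 2.
Proof. by rewrite mxE; apply: eq_bigr => i _; rewrite mxE. Qed.

Lemma exists_left_kernel m n (C : 'M[R]_(m, n)) : (n < m)%N ->
  exists2 y : 'rV_m, y != 0 & y *m C = 0.
Proof.
move=> nm; have : kermx C != 0.
  by rewrite -mxrank_eq0 mxrank_ker subn_eq0 -ltnNge (leq_ltn_trans (rank_leq_col _)).
by case/rowV0Pn => y /sub_kermxP yC y0; exists y.
Qed.

(* Cauchy interlacing, in a basis where both matrices are diagonal. *)
Lemma cauchy_interlacing m n (T : 'M[R]_(m, n)) (lam th : nat -> R) :
    T *m T^T = 1%:M ->
    T *m diag_mx (\row_i lam i) *m T^T = diag_mx (\row_i th i) ->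
    (forall i j, (i <= j < n)%N -> lam j <= lam i) ->
    (forall i j, (i <= j < m)%N -> th j <= th i) ->
  (m <= n)%N /\ forall i, (i < m)%N -> lam (n - m + i)%N <= th i <= lam i.
Proof.
move=> TT Tdiag lamS thS.
have lemn : (m <= n)%N.
  rewrite -(@mxrank1 R m) -TT (leq_trans (mxrankM_maxl _ _)) ?rank_leq_col//.
split=> // i lt_im.
have quad (y : 'rV_m) :
    \sum_(l < m) th l * y 0 l ^+ 2 = \sum_(k < n) lam k * (y *m T) 0 k ^+ 2.
  by rewrite -!quad_diag -Tdiag trmx_mul !mulmxA.
have norm (y : 'rV_m) : \sum_l y 0 l ^+ 2 = \sum_k (y *m T) 0 k ^+ 2.
  by rewrite -!dot_sum trmx_mul mulmxA -(mulmxA y) TT mulmx1.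
have norm_gt0 (y : 'rV[R]_m) : y != 0 -> 0 < \sum_l y 0 l ^+ 2.
  by move=> y0; rewrite -dot_sum lt_def dot_eq0 y0 dot_ge0.
have lt_m1 : (m.-1 < m)%N by case: (m) lt_im.
have le_m1n : (m.-1 <= n)%N by lia.
have lt_shift (k : 'I_m.-1) : (n - m + k.+1 < n)%N by have := ltn_ord k; lia.
apply/andP; split.
(* The equation [y *m C = 0] imposes [m.-1] conditions: [y] vanishes at the [i] indices below [i],
   and [y *m T] at the [m.-1 - i] indices above [n - m + i]. For such a nonzero [y], the common
   value of the two quadratic forms is at least [lam (n - m + i)] and at most [th i] times the
   squared norm. *)
- pose C : 'M[R]_(m, m.-1) := \matrix_(l, k)
    if (k < i)%N then (l == k :> nat)%:R else T l (Ordinal (lt_shift k)).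
  have [y y0 yC] := exists_left_kernel C lt_m1.
  have y_lo (l : 'I_m) : (l < i)%N -> y 0 l = 0.
    move=> lti; have lt_lm1 : (l < m.-1)%N by lia.
    have /rowP/(_ (Ordinal lt_lm1)) := yC; rewrite !mxE (bigD1 l)//= mxE/= lti eqxx.
    rewrite mulr1 big1 ?addr0// => l' l'l; rewrite mxE/= lti.
    by rewrite (_ : (_ == _ :> nat) = false) ?mulr0//; apply: negbTE.
  have yT_hi (k : 'I_n) : (n - m + i < k)%N -> (y *m T) 0 k = 0.
    move=> ltk; have lt_km1 : (k - (n - m).+1 < m.-1)%N by have := ltn_ord k; lia.
    have /rowP/(_ (Ordinal lt_km1)) := yC; rewrite !mxE => yk; rewrite -[RHS]yk.
    apply: eq_bigr => l _; rewrite mxE/= ifF; last by lia.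
    by congr (_ * T _ _); apply: val_inj => /=; lia.
  rewrite -(ler_pM2r (norm_gt0 _ y0)) {1}norm !mulr_sumr.
  apply: (@le_trans _ _ (\sum_(k < n) lam k * (y *m T) 0 k ^+ 2)).
    apply: ler_sum => k _; have [le_k|lt_k] := leqP k (n - m + i).
      rewrite ler_wpM2r ?sqr_ge0// lamS// ?ltn_ord ?andbT//; lia.
    by rewrite yT_hi// expr0n !mulr0.
  rewrite -quad; apply: ler_sum => l _; have [le_l|lt_l] := leqP i l.
    by rewrite ler_wpM2r ?sqr_ge0// thS// ?ltn_ord ?le_l ?lt_im.
  by rewrite y_lo// expr0n !mulr0.
(* Dually, [y *m T] vanishes below [i] and [y] above [i], whence the shift [k.+1]. *)
- pose C : 'M[R]_(m, m.-1) := \matrix_(l, k)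
    if (k < i)%N then T l (widen_ord le_m1n k) else (l == k.+1 :> nat)%:R.
  have [y y0 yC] := exists_left_kernel C lt_m1.
  have y_hi (l : 'I_m) : (i < l)%N -> y 0 l = 0.
    move=> lti; have lt_lm1 : (l.-1 < m.-1)%N by have := ltn_ord l; lia.
    have /rowP/(_ (Ordinal lt_lm1)) := yC; rewrite !mxE (bigD1 l)//= mxE/=.
    have [lE ->] : l.-1.+1 = l /\ (l.-1 < i)%N = false by lia.
    rewrite lE eqxx mulr1 big1 ?addr0// => l' l'l; rewrite mxE/= ifF; last by lia.
    by rewrite lE (_ : (_ == _ :> nat) = false) ?mulr0//; apply: negbTE.
  have yT_lo (k : 'I_n) : (k < i)%N -> (y *m T) 0 k = 0.
    move=> ltk; have lt_km1 : (k < m.-1)%N by lia.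
    have /rowP/(_ (Ordinal lt_km1)) := yC; rewrite !mxE => yk; rewrite -[RHS]yk.
    apply: eq_bigr => l _; rewrite mxE/= ltk.
    by congr (_ * T _ _); apply: val_inj.
  rewrite -(ler_pM2r (norm_gt0 _ y0)) {2}norm !mulr_sumr.
  apply: (@le_trans _ _ (\sum_(l < m) th l * y 0 l ^+ 2)).
    apply: ler_sum => l _; have [le_l|lt_l] := leqP l i.
      by rewrite ler_wpM2r ?sqr_ge0// thS// lt_im le_l.
    by rewrite y_hi// expr0n !mulr0.
  rewrite quad; apply: ler_sum => k _; have [le_k|lt_k] := leqP i k.
    by rewrite ler_wpM2r ?sqr_ge0// lamS// le_k ltn_ord.
  by rewrite yT_lo// expr0n !mulr0.
Qed.
End Spectral.

Lemma eigenvalues_nonincreasing (R : realType) n (N : 'M[R]_n) (s : n.-tuple R) :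
  eigenvalues_of N s -> forall i j, (i <= j < n)%N -> s`_j <= s`_i.
Proof.
case=> s_sorted _ i j /andP[ij lt_jn].
apply: (sorted_leq_nth _ _ _ s_sorted) => //; rewrite ?inE ?size_tuple//.
- by move=> x y z yx xz; exact: le_trans xz yx.
- exact: lexx.
- exact: leq_ltn_trans lt_jn.
Qed.

(** * First-step analysis of the passage times to a fixed state *)

Section FirstPassage.
Variables (R : realType) (n : nat) (P : 'M[R]_n) (i : 'I_n).
Hypotheses (P_ge0 : forall j k, 0 <= P j k) (P_sum1 : forall j, \sum_k P j k = 1).
(** Injectivity of the identity minus the chain killed at [i]. It serves twice: to solve the
    first-step equations, and to show that [i] is reached almost surely. *)
Hypothesis absorbing : forall x : 'I_n -> R,
  (forall j, x j = \sum_(k | k != i) P j k * x k) -> forall j, x j = 0.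

Local Notation f := (fun j t => first_passage_prob P j i t).

Lemma first_passage_prob_ge0 j t : 0 <= f j t.
Proof.
apply: sumr_ge0 => w _; elim: {t w}(tval w) j => //= k w IHw j.
by rewrite mulr_ge0.
Qed.

Lemma first_passage_prob0 j : f j 0 = 0.
Proof. by rewrite /first_passage_prob big_pred0. Qed.

(** Condition on the first step, by splitting a word into head and tail: a head equal to [i] ends
    the passage at once, any other head [k] leaves a passage from [k]. *)
Lemma first_passage_probS j t :
  f j t.+1 = P j i * (t == 0%N)%:R + \sum_(k | k != i) P j k * f k t.
Proof.
rewrite /first_passage_prob.
rewrite (reindex (fun p : 'I_n * t.-tuple 'I_n => [tuple of p.1 :: p.2])); last first.
  exists (fun w => (thead w, [tuple of behead w])) => [[k w] _|w _] /=.
    by congr (_, _); apply: val_inj.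
  by rewrite [RHS]tuple_eta.
transitivity (\sum_k \sum_(w : t.-tuple 'I_n | (index i (k :: w)).+1 == t.+1)
   P j k * walk_prob P k w).
  by rewrite pair_big_dep.
rewrite (bigD1 i)//=; congr (_ + _); last first.
  apply: eq_bigr => k ki; rewrite mulr_sumr; apply: eq_bigl => w.
  by rewrite (negbTE ki) eqSS.
rewrite eqxx eqSS; case: t => [|t]/=; last by rewrite big_pred0// mulr0.
rewrite (big_pred1 [tuple]) /= ?mulr1// => w.
by apply/esym/eqP; rewrite [w]tuple0.
Qed.

(** [F j N] is the probability that the passage takes fewer than [N] steps; the [A j N] are the
    partial sums of the expectation. *)
Let F j N := \sum_(0 <= t < N) f j t.
Let A j N := \sum_(0 <= t < N) t%:R * f j t.

Lemma cumulative_probS j N :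
  F j N.+1 = P j i * (0 < N)%:R + \sum_(k | k != i) P j k * F k N.
Proof.
rewrite /F big_nat_recl// first_passage_prob0 add0r.
under eq_bigr do rewrite first_passage_probS.
rewrite big_split/= exchange_big/=; congr (_ + _).
  case: N => [|N]; first by rewrite big_nil mulr0.
  by rewrite big_nat_recl//= big1 ?addr0// => t _; rewrite mulr0.
by apply: eq_bigr => k _; rewrite mulr_sumr.
Qed.

(** In the weight [t + 1] of [f j t.+1], the 1 contributes [F], and the [t] contributes the means
    after the first step; a direct jump to [i] has [t = 0] and adds nothing there. *)
Lemma partial_meanS j N : A j N.+1 = F j N.+1 + \sum_(k | k != i) P j k * A k N.
Proof.
rewrite /A /F !big_nat_recl// first_passage_prob0 mulr0 !add0r.
have -> : \sum_(k | k != i) P j k * (\sum_(0 <= t < N) t%:R * f k t) =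
   \sum_(0 <= t < N) t%:R * f j t.+1.
  under eq_bigr do rewrite mulr_sumr.
  rewrite exchange_big/=; apply: eq_bigr => t _.
  rewrite first_passage_probS mulrDr mulr_sumr.
  rewrite [X in _ = X + _](_ : _ = 0) ?add0r.
    by apply: eq_bigr => k _; ring.
  by case: t => [|t]; rewrite ?mul0r// !mulr0.
by rewrite -big_split/=; apply: eq_bigr => t _; rewrite -natr1 mulrDl mul1r addrC.
Qed.

Lemma avoiding_sum_le1 j : \sum_(k | k != i) P j k <= 1.
Proof. by rewrite -(P_sum1 j) [leRHS](bigD1 i)//= lerDr. Qed.

(* [u] will bound the partial sums of the mean first passage times. *)
Lemma mean_time_bound : exists2 u : 'I_n -> R, forall j, 0 <= u j &
  forall j, u j = 1 + \sum_(k | k != i) P j k * u k.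
Proof.
(* The transpose of the identity minus the killed chain, since [x] is a row vector. *)
pose G : 'M[R]_n := \matrix_(k, j) ((j == k)%:R - (k != i)%:R * P j k).
have GE (x : 'rV_n) j : (x *m G) 0 j = x 0 j - \sum_(k | k != i) P j k * x 0 k.
  rewrite mxE; under eq_bigr do rewrite mxE mulrBr.
  rewrite sumrB; congr (_ - _).
    rewrite (bigD1 j)//= eqxx mulr1 big1 ?addr0// => k kj.
    by rewrite eq_sym (negbTE kj) mulr0.
  rewrite [RHS]big_mkcond/=; apply: eq_bigr => k _.
  by case: ifP => _; rewrite /= ?mul1r ?mul0r ?mulr0// mulrC.
have Gu : G \in unitmx.
  rewrite -row_free_unit -kermx_eq0; apply: contraT => /rowV0Pn[x /sub_kermxP xG].
  apply: contraR => _; apply/eqP/rowP => j; rewrite [RHS]mxE.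
  apply: (absorbing (x := fun j => x 0 j)) => {}j; apply/eqP.
  by rewrite -subr_eq0 -GE xG mxE.
have [u uG] : exists u : 'rV_n, u *m G = const_mx 1.
  by exists (const_mx 1 *m invmx G); rewrite mulmxKV.
have uE j : u 0 j = 1 + \sum_(k | k != i) P j k * u 0 k.
  have /rowP/(_ j) := uG.
  by rewrite GE mxE => /eqP; rewrite subr_eq => /eqP.
exists (u 0) => // j0.
(* Minimum principle: a negative minimum [u 0 j] would satisfy [u 0 j >= 1 + u 0 j], because the
   weights off [i] sum to at most 1. *)
have [j _ minj] := @Order.TotalTheory.arg_minP _ _ _ j0 xpredT (u 0) isT.
apply: le_trans (minj j0 isT); rewrite leNgt; apply/negP => uj_lt0.
suff : 1 + u 0 j <= u 0 j by rewrite gerDr ler10.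
rewrite [leRHS]uE lerD2l -[leLHS]mul1r.
apply: (@le_trans _ _ ((\sum_(k | k != i) P j k) * u 0 j)).
  by rewrite ler_wnM2r ?avoiding_sum_le1// ltW.
by rewrite mulr_suml; apply: ler_sum => k _; rewrite ler_wpM2l// minj.
Qed.

(** Monotone bounded sequences converge, and the finite recurrence passes to the limit. This is
    applied first to [F], then to [A]. *)
Lemma limit_first_step (a b : 'I_n -> nat -> R) (u beta : 'I_n -> R) :
    (forall j, nondecreasing_seq (a j)) -> (forall j N, a j N <= u j) ->
    (forall j, b j @ \oo --> beta j)%classic ->
    (forall j N, a j N.+1 = b j N + \sum_(k | k != i) P j k * a k N) ->
  exists2 alpha : 'I_n -> R, forall j, (a j @ \oo --> alpha j)%classic &
    forall j, alpha j = beta j + \sum_(k | k != i) P j k * alpha k.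
Proof.
move=> a_nd a_ub b_cvg aS; exists (fun j => limn (a j)) => j.
  apply: nondecreasing_is_cvgn; first exact: a_nd.
  by exists (u j) => _ [N _ <-].
have a_cvg k : (a k @ \oo --> limn (a k))%classic.
  apply: nondecreasing_is_cvgn; first exact: a_nd.
  by exists (u k) => _ [N _ <-].
apply/cvg_lim => //; rewrite -cvg_shiftS/=.
under eq_fun do rewrite aS.
apply: cvgD => //; apply: cvg_big => [|k _]; first exact: add_continuous.
exact: cvgMl_tmp.
Qed.

Lemma mean_first_passage_time_fin : exists2 m : 'I_n -> R,
  forall j, mean_first_passage_time P j i = (m j)%:E &
  forall j, m j = 1 + \sum_(k | k != i) P j k * m k.
Proof.
have sum_nd (g : nat -> R) : (forall t, 0 <= g t) ->
    nondecreasing_seq (fun N => \sum_(0 <= t < N) g t).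
  by move=> g_ge0; apply/nondecreasing_seqP => N; rewrite big_nat_recr//= lerDl.
have F_nd j : nondecreasing_seq (F j).
  by apply: sum_nd => t; exact: first_passage_prob_ge0.
have A_nd j : nondecreasing_seq (A j).
  by apply: sum_nd => t; rewrite mulr_ge0// first_passage_prob_ge0.
have F_le1 j N : F j N <= 1.
  elim: N j => [|N IHN] j; first by rewrite /F big_nil.
  rewrite cumulative_probS -[leRHS](P_sum1 j) [leRHS](bigD1 i)//= lerD//.
    by rewrite ler_piMr// lern1 leq_b1.
  by apply: ler_sum => k _; rewrite ler_piMr.
have [u u_ge0 uE] := mean_time_bound.
have A_le j N : A j N <= u j.
  elim: N j => [|N IHN] j; first by rewrite /A big_nil.
  rewrite partial_meanS uE lerD//; apply: ler_sum => k _; exact: ler_wpM2l.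
have b_cvg j : ((fun N => P j i * (0 < N)%:R) @ \oo --> P j i)%classic.
  apply: cvg_near_cst; exists 1%N => // N /= N_gt0.
  by rewrite N_gt0 mulr1.
have [phi F_cvg phiE] := limit_first_step F_nd F_le1 b_cvg cumulative_probS.
(* Almost sure passage: [1 - phi] solves the homogeneous first-step equation. *)
have phi1 j : phi j = 1.
  apply/eqP; rewrite eq_sym -subr_eq0; apply/eqP; move: j.
  apply: (absorbing (x := fun j => 1 - phi j)) => j.
  rewrite phiE -{1}(P_sum1 j) (bigD1 i)//= opprD addrACA subrr add0r -sumrB.
  by apply: eq_bigr => k _; rewrite mulrBr mulr1.
have FS_cvg j : ((fun N => F j N.+1) @ \oo --> (1 : R))%classic.
  by rewrite -(phi1 j) cvg_shiftS.
have [m A_cvg mE] := limit_first_step A_nd A_le FS_cvg partial_meanS.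
exists m => // j; apply/cvg_lim => //.
apply: cvg_EFin; first by near=> N; rewrite sumEFin.
under eq_fun do rewrite /= sumEFin/=.
exact: A_cvg.
Unshelve. all: by end_near. Qed.

End FirstPassage.

(** * Dirichlet energy, the spectrum of the normalized adjacency matrix, and Kemeny's constant *)

Section Graph.
Variables (R : realType) (n : nat) (c : 'M[R]_n).
Hypotheses (n_gt1 : (1 < n)%N) (graph_c : is_weighted_graph c).

(** A vertex of degree 0 has no outgoing edge, so no path leads from it to a second vertex. *)
Lemma degree_gt0 i : 0 < degree c i.
Proof.
have [_ c_ge0 _ conn_c] := graph_c.
rewrite lt_def [_ <= _]sumr_ge0// andbT; apply/eqP => di0.
have ci0 k : c i k = 0.
  by apply/eqP; have /eqP := di0; rewrite psumr_eq0// => /allP/(_ k (mem_index_enum k)).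
have [k ki] : exists k, k != i.
  have /card_gt0P[k] : (0 < #|[pred k | k != i]|)%N.
    by rewrite (cardC1 i) card_ord; lia.
  by move=> ki; exists k.
have /connectP[[|k' s]/=] := conn_c i k.
  by move=> _ ik; rewrite ik eqxx in ki.
by rewrite /Defs.adjacent/= ci0 ltxx.
Qed.

Lemma degree_neq0 i : degree c i != 0.
Proof. by rewrite gt_eqF ?degree_gt0. Qed.

Lemma sqrt_degree_neq0 i : Num.sqrt (degree c i) != 0.
Proof. by rewrite gt_eqF ?sqrtr_gt0 ?degree_gt0. Qed.

Lemma sqrt_degreeK i : Num.sqrt (degree c i) ^+ 2 = degree c i.
Proof. by rewrite sqr_sqrtr// ltW ?degree_gt0. Qed.

Lemma transition_mxE i j : transition_mx c i j = c i j / degree c i.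
Proof.
rewrite /transition_mx; set D := degree_mx c.
have Du : D \in unitmx.
  rewrite unitmxE det_diag unitfE prodf_seq_neq0; apply/allP => k _.
  by rewrite mxE degree_neq0.
have -> : invmx D *m c = \matrix_(i, j) (c i j / degree c i).
  apply: (canLR (mulKmx Du)); apply/matrixP => k l.
  by rewrite mul_diag_mx !mxE mulrC divfK// degree_neq0.
by rewrite mxE.
Qed.

Lemma normalized_adjacencyE i j :
  normalized_adjacency c i j = c i j / (Num.sqrt (degree c i) * Num.sqrt (degree c j)).
Proof.
rewrite /normalized_adjacency/degree_mx_invsqrt.
by rewrite mul_mx_diag mul_diag_mx !mxE invfM; ring. Qed.

(** The sign [s = -1] gives the Dirichlet energy and [s = 1] its signless analogue; they bound
    eigenvalues from above and from below respectively. *)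
Lemma energyE (x : 'I_n -> R) (s : R) : s ^+ 2 = 1 ->
  \sum_i \sum_j c i j * (x i + s * x j) ^+ 2 =
  2 * \sum_i x i * (degree c i * x i + s * \sum_j c i j * x j).
Proof.
move=> s1; have [c_sym _ _ _] := graph_c.
have -> : \sum_i \sum_j c i j * (x i + s * x j) ^+ 2 =
   \sum_i \sum_j (c i j * x i ^+ 2 + s * x i * (c i j * x j)) +
   \sum_i \sum_j (c i j * x j ^+ 2 + s * x i * (c i j * x j)).
  rewrite -big_split/=; apply: eq_bigr => i _; rewrite -big_split/=.
  apply: eq_bigr => j _.
  rewrite [LHS](_ : _ = c i j * (x i ^+ 2 + 2 * s * x i * x j + s ^+ 2 * x j ^+ 2)).
    by rewrite s1; ring.
  by ring.
rewrite [X in _ + X]exchange_big/=.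
rewrite [X in _ + X](_ : _ =
   \sum_i \sum_j (c i j * x i ^+ 2 + s * x i * (c i j * x j))); last first.
  by apply: eq_bigr => i _; apply: eq_bigr => j _; rewrite (c_sym j); ring.
rewrite -mulr2n -[LHS]mulr_natl; congr (_ * _); apply: eq_bigr => i _.
rewrite big_split/= -mulr_suml -/(degree c i) -mulr_sumr; ring.
Qed.

(* Such an [x] has zero Dirichlet energy. *)
Lemma harmonic_const (x : 'I_n -> R) :
    (forall i, x i = 0 \/ degree c i * x i = \sum_j c i j * x j) ->
  forall i j, x i = x j.
Proof.
move=> xH; have [_ c_ge0 _ conn_c] := graph_c.
have := @energyE x (-1) (sqrr_sign _ 1).
(* Each vertex contributes 0 to the right-hand side: either the factor [x i] or the Laplacian of [x]
   at [i] vanishes. *)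
rewrite [X in _ = 2 * X]big1 ?mulr0 => [|i _]; last first.
  by case: (xH i) => ->; rewrite ?mul0r// mulN1r subrr mulr0.
move/eqP; rewrite psumr_eq0 => [/allP E0|i _]; last first.
  by apply: sumr_ge0 => j _; rewrite mulr_ge0 ?sqr_ge0.
have adj_eq i j : Defs.adjacent c i j -> x i = x j.
  rewrite /Defs.adjacent/= => cij; have := E0 i (mem_index_enum i).
  rewrite /= psumr_eq0 => [/allP/(_ j (mem_index_enum j))/=|k _]; last first.
    by rewrite mulr_ge0 ?sqr_ge0.
  by rewrite mulf_eq0 gt_eqF//= sqrf_eq0 mulN1r subr_eq0 => /eqP.
move=> i j; have /connectP[s] := conn_c i j.
elim: s i => [|k s IHs] i /=; first by move=> _ ->.
by case/andP => /adj_eq -> /IHs; apply.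
Qed.

(** The substitution [x = D^(-1/2) q] turns [M q = a q] into [A x = a D x]. *)
Lemma normalized_eigen (q : 'rV[R]_n) a :
    q *m normalized_adjacency c = a *: q ->
  forall j, \sum_i c j i * (q 0 i / Num.sqrt (degree c i)) =
    a * (degree c j * (q 0 j / Num.sqrt (degree c j))).
Proof.
move=> qM j; have [c_sym _ _ _] := graph_c.
have /rowP/(_ j) := qM; rewrite !mxE => qMj.
have sj := sqrt_degree_neq0 j.
have -> : degree c j * (q 0 j / Num.sqrt (degree c j)) =
    Num.sqrt (degree c j) * q 0 j.
  by rewrite -{1}sqrt_degreeK; field.
rewrite mulrCA -qMj mulr_sumr; apply: eq_bigr => i _.
rewrite normalized_adjacencyE (c_sym j); field.
by rewrite sj sqrt_degree_neq0.
Qed.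

(** For [x = D^(-1/2) q] the nonnegative energy equals [2 (1 + s a)] times the squared norm of
    [q]. *)
Lemma normalized_eigen_bound (q : 'rV[R]_n) a : q != 0 ->
  q *m normalized_adjacency c = a *: q -> -1 <= a <= 1.
Proof.
move=> q0 /normalized_eigen xH; pose x i := q 0 i / Num.sqrt (degree c i).
have {}xH j : \sum_i c j i * x i = a * (degree c j * x j) by exact: xH.
have [_ c_ge0 _ _] := graph_c.
have qq : 0 < \sum_i degree c i * x i ^+ 2.
  have -> : \sum_i degree c i * x i ^+ 2 = (q *m q^T) 0 0.
    rewrite dot_sum; apply: eq_bigr => i _.
    by rewrite /x -{1}sqrt_degreeK; field; exact: sqrt_degree_neq0.
  by rewrite lt_def dot_eq0 q0 dot_ge0.
have bound s : s ^+ 2 = 1 -> 0 <= 1 + s * a.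
  move=> s1; have : 0 <= \sum_i \sum_j c i j * (x i + s * x j) ^+ 2.
    by apply: sumr_ge0 => i _; apply: sumr_ge0 => j _; rewrite mulr_ge0 ?sqr_ge0.
  rewrite energyE// (_ : \sum_i _ = (1 + s * a) * \sum_i degree c i * x i ^+ 2).
    by rewrite pmulr_rge0// pmulr_lge0.
  by rewrite mulr_sumr; apply: eq_bigr => i _; rewrite xH; ring.
have := bound 1 (expr1n _ _); have := bound (-1) (sqrr_sign _ 1).
by rewrite mul1r mulN1r; lra.
Qed.

Lemma normalized_eigen1 (q : 'rV[R]_n) : q *m normalized_adjacency c = q ->
  exists t, forall i, q 0 i = t * Num.sqrt (degree c i).
Proof.
rewrite -[RHS]scale1r => /normalized_eigen xH.
have i0 : 'I_n by apply: (Ordinal n_gt1).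
exists (q 0 i0 / Num.sqrt (degree c i0)) => i.
rewrite (harmonic_const (x := fun i => q 0 i / Num.sqrt (degree c i)) _ i0 i).
  by rewrite divfK// sqrt_degree_neq0.
by move=> j; right; rewrite xH mul1r.
Qed.

Local Notation P := (transition_mx c).
Local Notation M := (normalized_adjacency c).

Lemma transition_ge0 i j : 0 <= P i j.
Proof.
by case: graph_c => _ c_ge0 _ _; rewrite transition_mxE divr_ge0// ltW ?degree_gt0. Qed.

Lemma transition_sum1 i : \sum_j P i j = 1.
Proof.
under eq_bigr do rewrite transition_mxE.
by rewrite -mulr_suml divff// degree_neq0.
Qed.

Lemma transition_harmonic_const (x : 'I_n -> R) :
    (forall i, x i = 0 \/ x i = \sum_j P i j * x j) -> forall i j, x i = x j.
Proof.
move=> xH; apply: (harmonic_const) => i.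
case: (xH i) => [->|xi]; [by left|right].
rewrite {1}xi mulr_sumr; apply: eq_bigr => j _; rewrite transition_mxE; field.
exact: degree_neq0.
Qed.

(** Resetting [x] to 0 at [i] gives a function that is zero or harmonic at every vertex, hence
    constant, hence 0. *)
Lemma transition_absorbing i (x : 'I_n -> R) :
  (forall j, x j = \sum_(k | k != i) P j k * x k) -> forall j, x j = 0.
Proof.
move=> xH; pose y j := if j == i then 0 else x j.
have sumE j : \sum_(k | k != i) P j k * x k = \sum_k P j k * y k.
  rewrite big_mkcond/=; apply: eq_bigr => k _.
  by rewrite /y; case: eqP => //= _; rewrite mulr0.
have y0 j : y j = 0.
  rewrite (@transition_harmonic_const y _ j i) => [|k]; first by rewrite /y eqxx.
  by rewrite {1 2}/y; case: ifP => _; [left|right; rewrite xH sumE].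
by move=> j; rewrite xH sumE big1// => k _; rewrite y0 mulr0.
Qed.

(** By symmetry of [c], the quotient of [p] by the degree is harmonic, hence constant. *)
Lemma stationary_degree (p : 'rV[R]_n) : is_stationary P p ->
  exists2 t, forall i, p 0 i = t * degree c i & t * \sum_i degree c i = 1.
Proof.
case=> _ p1 pP; have [c_sym _ _ _] := graph_c.
have i0 : 'I_n by apply: (Ordinal n_gt1).
have pE i : p 0 i = p 0 i0 / degree c i0 * degree c i.
  rewrite (harmonic_const (x := fun i => p 0 i / degree c i) _ i0 i).
    by rewrite divfK// degree_neq0.
  move=> j; right; rewrite mulrC divfK ?degree_neq0// -{1}pP mxE.
  by apply: eq_bigr => k _; rewrite transition_mxE (c_sym j k); ring.
exists (p 0 i0 / degree c i0) => //.
by rewrite -[RHS]p1 mulr_sumr; apply: eq_bigr => i _; rewrite -pE.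
Qed.

Lemma normalized_sym : M^T = M.
Proof.
apply/matrixP => i j; rewrite mxE !normalized_adjacencyE mulrC.
by case: graph_c => -> _ _ _; rewrite (mulrC (Num.sqrt _)) mulrC.
Qed.

Lemma normalized_spectrum (lambda : n.-tuple R) : eigenvalues_of M lambda ->
  exists Q : 'M[R]_n, [/\ Q *m Q^T = 1%:M, M = Q^T *m diag_mx (\row_i lambda`_i) *m Q,
    (forall i, (i < n)%N -> -1 <= lambda`_i <= 1) &
    (forall i, (0 < i < n)%N -> lambda`_i < 1)].
Proof.
move=> lamP; have [_ chM] := lamP.
have [Q [QQ ME]] := sym_spectral normalized_sym (size_tuple lambda) chM.
have rowQ (i : 'I_n) : row i Q *m M = lambda`_i *: row i Q.
  rewrite ME !mulmxA -row_mul QQ row1 -rowE row_diag_mx -scalemxAl mxE.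
  by rewrite -rowE.
have dotQ (i j : 'I_n) : (row i Q *m (row j Q)^T) 0 0 = (i == j)%:R.
  have /matrixP/(_ i j) := QQ; rewrite [in RHS]mxE => <-.
  by rewrite !mxE; apply: eq_bigr => k _; rewrite !mxE.
have rowQ0 (i : 'I_n) : row i Q != 0.
  by rewrite -dot_eq0 dotQ eqxx oner_eq0.
have bound i : (i < n)%N -> -1 <= lambda`_i <= 1.
  by move=> lt_in; exact: normalized_eigen_bound (rowQ0 (Ordinal lt_in)) (rowQ _).
exists Q; split => // i /andP[i_gt0 lt_in].
have /andP[_] := bound _ lt_in; rewrite le_eqVlt => /predU1P[lam1|//].
have n_gt0 := ltnW n_gt1.
have lam0 : lambda`_0 = 1.
  apply/le_anti; have /andP[_ ->] /= := bound _ n_gt0.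
  by rewrite -lam1 (eigenvalues_nonincreasing lamP).
pose i1 := Ordinal lt_in; pose i0 := Ordinal n_gt0.
have [t tE] : exists t, forall k, row i1 Q 0 k = t * Num.sqrt (degree c k).
  by apply: normalized_eigen1 => //; rewrite rowQ /= lam1 scale1r.
have [s sE] : exists s, forall k, row i0 Q 0 k = s * Num.sqrt (degree c k).
  by apply: normalized_eigen1 => //; rewrite rowQ /= lam0 scale1r.
have dotE (x y : 'rV_n) a b : (forall k, x 0 k = a * Num.sqrt (degree c k)) ->
    (forall k, y 0 k = b * Num.sqrt (degree c k)) ->
    (x *m y^T) 0 0 = a * b * \sum_k degree c k.
  move=> xE yE; rewrite mxE mulr_sumr; apply: eq_bigr => k _.
  by rewrite mxE xE yE -[in RHS]sqrt_degreeK; ring.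
(* If 1 were a repeated eigenvalue, two orthogonal unit rows of [Q] would both be multiples of the
   vector of square roots of degrees. *)
have /eqP := dotQ i1 i0; rewrite (dotE _ _ _ _ tE sE) -val_eqE/= gtn_eqF// !mulf_eq0.
case/orP => [/orP[]|] /eqP z0.
- by have /eqP := dotQ i1 i1; rewrite (dotE _ _ _ _ tE tE) z0 !mul0r eqxx
    eq_sym oner_eq0.
- by have /eqP := dotQ i0 i0; rewrite (dotE _ _ _ _ sE sE) z0 !mul0r eqxx
    eq_sym oner_eq0.
- by have /eqP := dotQ i0 i0; rewrite (dotE _ _ _ _ sE sE) z0 !mulr0 eqxx
    eq_sym oner_eq0.
Qed.

Lemma kemeny_spectral (lambda : n.-tuple R) (p : 'rV[R]_n) j :
    eigenvalues_of M lambda -> is_stationary P p ->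
  kemeny P p j = (\sum_(1 <= i < n) 1 / (1 - lambda`_i))%:E.
Proof.
move=> lamP p_stat; have [_ p1 pP] := p_stat.
have [c_sym _ _ _] := graph_c.
have [t pE t_vol] := stationary_degree p_stat.
have /all_sig2[m mE m_step] : forall i, {m : 'I_n -> R |
    forall j, mean_first_passage_time P j i = (m j)%:E &
    forall j, m j = 1 + \sum_(k | k != i) P j k * m k}.
  move=> i; apply: cid2.
  apply: mean_first_passage_time_fin transition_ge0 transition_sum1 _.
  exact: transition_absorbing.
pose Y k i := p 0 i * m i k - (k == i)%:R.
(* Kac's formula: average the first-step equations against [p] and cancel the terms with
   [k != i]. *)
have p_return i : p 0 i * m i i = 1.
  have : \sum_k p 0 k * m i k = 1 + \sum_(k | k != i) p 0 k * m i k.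
    transitivity (\sum_k (p 0 k + \sum_(l | l != i) p 0 k * P k l * m i l)).
      apply: eq_bigr => k _; rewrite m_step mulrDr mulr1 mulr_sumr.
      by congr (_ + _); apply: eq_bigr => l _; rewrite mulrA.
    rewrite big_split/= p1 exchange_big/=; congr (_ + _); apply: eq_bigr => l _.
    by rewrite -mulr_suml -{2}pP mxE.
  by rewrite (bigD1 i)//= => /addIr.
(* The term [l = i], absent from the first-step equation, may be added since [Y i i = 0]. *)
have YE k i : Y k i = p 0 i + \sum_l P k l * Y l i - (k == i)%:R.
  rewrite /Y m_step mulrDr mulr1 mulr_sumr; congr (_ + _ - _).
  rewrite [RHS](bigD1 i)//= p_return eqxx subrr mulr0 add0r.
  by apply: eq_bigr => l /negbTE ->; rewrite subr0; ring.
have Y_diag i : Y i i = 0 by rewrite /Y p_return eqxx subrr.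
pose K k := \sum_i Y k i.
(* The rows of [1 pi] and of the identity both sum to 1, so [K] is harmonic. *)
have K_const k l : K k = K l.
  apply: transition_harmonic_const => {}k; right; rewrite /K.
  under eq_bigr do rewrite YE.
  rewrite sumrB big_split/= p1 exchange_big/= [X in _ - X](_ : _ = 1).
    by rewrite addrAC subrr add0r; apply: eq_bigr => i _; rewrite mulr_sumr.
  by rewrite (bigD1 k)//= eqxx big1 ?addr0// => i ik; rewrite eq_sym (negbTE ik).
have -> : kemeny P p j = (K j)%:E.
  rewrite /kemeny /K /Y; under eq_bigr do rewrite mE -EFinM.
  rewrite sumEFin -EFinB sumrB; congr (_ - _)%:E.
  by rewrite (bigD1 j)//= eqxx big1 ?addr0// => i ij; rewrite eq_sym (negbTE ij).
congr EFin.
have [Q [QQ ME _ lam_lt1]] := normalized_spectrum lamP.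
have QQ' : Q^T *m Q = 1%:M by exact: mulmx1C.
pose w : 'rV[R]_n := \row_i Num.sqrt (degree c i).
pose S : 'M[R]_n := \matrix_(k, i) (w 0 k * Y k i / w 0 i).
have w_neq0 k : w 0 k != 0 by rewrite mxE sqrt_degree_neq0.
have w_sqr k : w 0 k ^+ 2 = degree c k by rewrite mxE sqrt_degreeK.
have entryE (x : 'rV[R]_n) (A : 'M[R]_n) k i : (t *: (x^T *m x) + A - 1%:M) k i =
    t * (x 0 k * x 0 i) + A k i - (k == i)%:R.
  rewrite mxE; congr (_ + _); last by rewrite !mxE.
  by rewrite mxE; congr (_ + _); rewrite 2!mxE big_ord1 mxE.
pose L := diag_mx (\row_(i < n) lambda`_i).
(* The equation for [Y] conjugated by [D^(1/2)]; the rank one term becomes symmetric because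
   [p 0 i = t * w 0 i ^+ 2]. *)
have SE : S = t *: (w^T *m w) + M *m S - 1%:M.
  apply/matrixP => k i; rewrite entryE [LHS]mxE YE pE -w_sqr.
  have -> : (M *m S) k i = w 0 k * (\sum_l P k l * Y l i) / w 0 i.
    rewrite mxE mulr_sumr mulr_suml; apply: eq_bigr => l _.
    rewrite [S l i]mxE normalized_adjacencyE transition_mxE.
    have wE e : Num.sqrt (degree c e) = w 0 e by rewrite mxE.
    by rewrite !wE -w_sqr; field; rewrite !w_neq0.
  by case: eqP => [->|_]; rewrite /= ?mulr1n ?mulr0n; field.
pose Z := Q *m S *m Q^T; pose v := w *m Q^T.
have ZE : Z = t *: (v^T *m v) + L *m Z - 1%:M.
  rewrite /Z {1}SE mulmxBr mulmxBl mulmxDr mulmxDl mulmx1 QQ -scalemxAr -scalemxAl.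
  by rewrite {1}ME /v trmx_mul trmxK !mulmxA QQ mul1mx.
have wM : w *m M = w.
  apply/rowP => k; rewrite mxE.
  transitivity (\sum_l c k l / w 0 k).
    apply: eq_bigr => l _; rewrite normalized_adjacencyE (c_sym l) !mxE; field.
    by rewrite !sqrt_degree_neq0.
  rewrite -mulr_suml -/(degree c k) -{1}sqrt_degreeK !mxE; field.
  exact: sqrt_degree_neq0.
have vL : v *m L = v.
  by rewrite /v -[in RHS]wM ME !mulmxA -[RHS]mulmxA QQ mulmx1.
have n_gt0 := ltnW n_gt1; pose i0 := Ordinal n_gt0.
(* The vector [w] is fixed by [M], and only the eigenvalue of index 0 can equal 1. *)
have v0 (i : 'I_n) : i != i0 -> v 0 i = 0.
  move=> ii0; have /rowP/(_ i) := vL; rewrite mul_mx_diag mxE.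
  rewrite [X in _ * X = _]mxE => /eqP; rewrite -subr_eq0 -{2}[v 0 i]mulr1 -mulrBr mulf_eq0 => /orP[/eqP//|].
  by rewrite subr_eq0 lt_eqF// lam_lt1// ltn_ord andbT lt0n.
have vv : t * v 0 i0 ^+ 2 = 1.
  transitivity (t * (v *m v^T) 0 0).
    rewrite dot_sum (bigD1 i0)//= [X in _ + X]big1 ?addr0// => i ii0.
    by rewrite v0// expr0n.
  rewrite /v trmx_mul trmxK mulmxA -(mulmxA w) QQ' mulmx1 dot_sum -[RHS]t_vol.
  by congr (_ * _); apply: eq_bigr => i _; rewrite mxE sqrt_degreeK.
have Zd (i : 'I_n) : Z i i = t * v 0 i ^+ 2 + lambda`_i * Z i i - 1.
  rewrite {1}ZE entryE eqxx -expr2; congr (_ + _ - _).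
  by rewrite mul_diag_mx mxE [X in X * _ = _]mxE.
(* Both sides equal [t * (w *m S *m w^T) 0 0], which averages the constant [K] with weights
   [t * degree c k] of sum 1. *)
have KZ : K j = Z i0 i0.
  have vT i : v^T i 0 = v 0 i by exact: mxE.
  have <- : t * (v *m Z *m v^T) 0 0 = Z i0 i0.
    rewrite mxE (bigD1 i0)//= [X in _ + X]big1 ?addr0 => [|i ii0]; last first.
      by rewrite vT v0// mulr0.
    rewrite mxE vT (bigD1 i0)//= [X in _ + X]big1 ?addr0 => [|i ii0]; last first.
      by rewrite v0// mul0r.
    by rewrite -[RHS]mul1r -vv; ring.
  have -> : v *m Z *m v^T = w *m S *m w^T.
    rewrite /v /Z trmx_mul trmxK !mulmxA -(mulmxA w) QQ' mulmx1.
    by rewrite -(mulmxA (w *m S)) QQ' mulmx1.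
  rewrite -[LHS]mul1r -t_vol -mulrA; congr (_ * _).
  transitivity (\sum_i \sum_k degree c k * Y k i).
    rewrite [RHS]exchange_big mulr_suml/=; apply: eq_bigr => k _.
    by rewrite -mulr_sumr (K_const j k).
  rewrite mxE; apply: eq_bigr => i _; rewrite mxE mulr_suml; apply: eq_bigr => k _.
  by rewrite [S k i]mxE [w^T i 0]mxE -w_sqr; field.
have trZ : \sum_i Z i i = 0.
  rewrite -/(\tr Z) /Z mxtrace_mulC mulmxA QQ' mul1mx.
  by rewrite /mxtrace big1// => i _; rewrite mxE Y_diag mulr0 mul0r.
pose F i := 1 / (1 - lambda`_i).
have -> : \sum_(1 <= i < n) 1 / (1 - lambda`_i) = \sum_(i | i != i0) F i.
  have : \sum_(0 <= i < n) F i = F 0%N + \sum_(i | i != i0) F i.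
    by rewrite big_mkord (bigD1 i0).
  by rewrite big_ltn// => /addrI.
apply/eqP; rewrite KZ -subr_eq0 -[eqbRHS]trZ [eqbRHS](bigD1 i0)//=; apply/eqP.
congr (_ + _); rewrite -sumrN; apply: eq_bigr => i ii0.
have := Zd i; rewrite v0// expr0n mulr0 add0r => ZE'.
have lam_neq1 : 1 - lambda`_i != 0.
  by rewrite subr_eq0 gt_eqF// lam_lt1// ltn_ord andbT lt0n.
apply: (mulfI lam_neq1); rewrite mulrN /F mulrC divfK//.
by rewrite mulrBl mul1r {1}ZE' addrAC subrr add0r.
Qed.
End Graph.

(** * Principal submatrices and quotient matrices as compressions *)

Lemma principal_compression (R : realType) n m (N : 'M[R]_n) (B : 'M[R]_m) :
  is_principal_submx N B -> exists S : 'M[R]_(m, n),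
    S *m S^T = 1%:M /\ char_poly (S *m N *m S^T) = char_poly B.
Proof.
case=> f f_inj ->; exists (rowsub f 1%:M); split.
  apply/matrixP => i j; rewrite mxE (bigD1 (f i))//= !mxE eqxx mul1r big1 ?addr0.
    by rewrite (inj_eq f_inj) eq_sym.
  by move=> k ki; rewrite !mxE eq_sym (negbTE ki) mul0r.
congr char_poly; rewrite mul_rowsub_mx mul1mx; apply/matrixP => i j.
rewrite mxE (bigD1 (f j))//= !mxE eqxx mulr1 big1 ?addr0// => k kj.
by rewrite !mxE eq_sym (negbTE kj) mulr0.
Qed.

(** The rows of [S] are the normalized indicator vectors of the parts. The compression is symmetric
    when [N] is, and is the quotient matrix conjugated by the diagonal matrix of the square roots of
    the part sizes. *)
Lemma quotient_compression (R : realType) n m (N : 'M[R]_n) (W : 'I_m -> {set 'I_n}) :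
  is_indexed_partition W -> exists S : 'M[R]_(m, n),
    S *m S^T = 1%:M /\ char_poly (S *m N *m S^T) = char_poly (quotient_mx N W).
Proof.
case=> W_inj /and3P[_ /finset.trivIsetP W_triv W_n0].
pose r i : R := Num.sqrt #|W i|%:R.
have W_gt0 i : 0 < #|W i|%:R :> R.
  rewrite ltr0n lt0n cards_eq0; apply: contraNneq W_n0 => <-.
  exact: imset_f.
have r_neq0 i : r i != 0 by rewrite gt_eqF ?sqrtr_gt0.
have r_sqr i : r i ^+ 2 = #|W i|%:R by rewrite sqr_sqrtr ?ltW.
pose S : 'M[R]_(m, n) := \matrix_(i, u) ((u \in W i)%:R / r i).
have SS : S *m S^T = 1%:M.
  apply/matrixP => i j; rewrite mxE [RHS]mxE.
  transitivity (\sum_u ((u \in W i) && (u \in W j))%:R / (r i * r j)).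
    by apply: eq_bigr => u _; rewrite !mxE -mulnb natrM invfM; ring.
  rewrite -mulr_suml; have [<-|ij] := eqVneq i j.
    under eq_bigr do rewrite andbb.
    by rewrite -natr_sum -big_mkcond/= sum1_card -expr2 r_sqr divff// gt_eqF.
  rewrite big1 ?mul0r// => u _.
  have := W_triv (W i) (W j) (imset_f _ _) (imset_f _ _).
  rewrite (inj_eq W_inj) ij => /(_ isT isT isT) /pred0P/(_ u) /= -> //.
exists S; split=> //.
have -> : S *m N *m S^T = diag_mx (\row_i r i) *m quotient_mx N W *m
    diag_mx (\row_i (r i)^-1).
  apply/matrixP => i j; rewrite mul_mx_diag mul_diag_mx !mxE -r_sqr.
  transitivity (\sum_(u in W i) \sum_(v in W j) N u v / (r i * r j)); last first.
    under eq_bigr do rewrite -mulr_suml.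
    by rewrite -mulr_suml; field; rewrite !r_neq0.
  rewrite exchange_big/= [RHS]big_mkcond/=; apply: eq_bigr => v _.
  rewrite mxE mulr_suml; case: ifP => vj; last first.
    by rewrite big1// => u _; rewrite [S^T _ _]mxE [S _ _]mxE vj mul0r mulr0.
  rewrite [RHS]big_mkcond/=; apply: eq_bigr => u _.
  rewrite [S^T _ _]mxE ![S _ _]mxE vj invfM.
  by case: ifP => _; rewrite /= ?mulr1n ?mulr0n; ring.
apply: char_poly_conj; apply/matrixP => i j; rewrite mul_diag_mx !mxE.
by have [->|] := eqVneq i j; rewrite /= ?mulr0// ?mulr1n ?mulfV.
Qed.

(** Diagonalizing [N] by [Q] and its compression by [U] reduces the claim to the diagonal case, with
    [T = U S Q^T]. *)
Lemma compression_interlacing (R : realType) n m (N : 'M[R]_n) (B : 'M[R]_m)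
    (lambda : n.-tuple R) (theta : m.-tuple R) (S : 'M[R]_(m, n)) :
  N^T = N -> eigenvalues_of N lambda -> eigenvalues_of B theta ->
  S *m S^T = 1%:M -> char_poly (S *m N *m S^T) = char_poly B ->
  (m <= n)%N /\ forall i, (i < m)%N -> lambda`_(n - m + i) <= theta`_i <= lambda`_i.
Proof.
move=> symN lamP theP SS chB.
have [Q [QQ NE]] := sym_spectral symN (size_tuple lambda) lamP.2.
have [||U [UU BE]] := sym_spectral (N := S *m N *m S^T) _ (size_tuple theta).
- by rewrite !trmx_mul trmxK symN mulmxA.
- by rewrite chB theP.2.
have QQ' : Q^T *m Q = 1%:M by exact: mulmx1C.
apply: (@cauchy_interlacing _ _ _ (U *m S *m Q^T) (nth 0 lambda) (nth 0 theta)).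
- rewrite !trmx_mul trmxK -!mulmxA (mulmxA Q^T) QQ' mul1mx (mulmxA S) SS mul1mx.
  by rewrite UU.
- rewrite !trmx_mul trmxK.
  transitivity (U *m (S *m N *m S^T) *m U^T); first by rewrite NE !mulmxA.
  by rewrite BE !mulmxA UU mul1mx -mulmxA UU mulmx1.
- exact: eigenvalues_nonincreasing lamP.
- exact: eigenvalues_nonincreasing theP.
Qed.

(** * The two bounds on Kemeny's constant *)

Theorem theorem5p5 (R : realType) (n m : nat) (c : 'M[R]_n)
    (lambda : n.-tuple R) (B : 'M[R]_m) (theta : m.-tuple R)
    (p : 'rV[R]_n) (j : 'I_n)
    (hn : (2 <= n)%N) (hm : (1 <= m)%N)
    (hG : is_weighted_graph c)
    (hlambda : eigenvalues_of (normalized_adjacency c) lambda)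
    (htheta : eigenvalues_of B theta)
    (hB : is_principal_submx (normalized_adjacency c) B \/
          exists2 W : 'I_m -> {set 'I_n}, is_indexed_partition W &
            B = quotient_mx (normalized_adjacency c) W)
    (hp : is_stationary (transition_mx c) p) :
  ((\sum_(1 <= i < m) 1 / (1 - theta`_i) + (n%:R - m%:R) / 2)%:E
     <= kemeny (transition_mx c) p j)%E /\
  (kemeny (transition_mx c) p j
     <= (\sum_(1 <= i < m) 1 / (1 - theta`_i)
          + (n%:R - m%:R) / (1 - lambda`_1))%:E)%E.
Proof.
have symM := normalized_sym hG.
have [S [SS chB]] : exists S : 'M[R]_(m, n), S *m S^T = 1%:M /\
    char_poly (S *m normalized_adjacency c *m S^T) = char_poly B.
  by case: hB => [/principal_compression//|[W /quotient_compression + ->]].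
have [le_mn inter] := compression_interlacing symM hlambda htheta SS chB.
have [_ [_ _ lam_bound lam_lt1]] := normalized_spectrum hn hG hlambda.
rewrite (kemeny_spectral hn hG j hlambda hp) !lee_fin.
have inv_le x y : x <= y -> y < 1 -> 1 / (1 - x) <= 1 / (1 - y) :> R.
  move=> xy y1; rewrite !div1r lef_pV2 ?posrE ?subr_gt0//; last exact: le_lt_trans y1.
  by rewrite lerD2l lerN2.
split.
- rewrite (big_cat_nat hm le_mn)/= lerD//.
    apply: ler_sum_nat => i /andP[i_gt0 lt_im]; have /andP[_ th_lam] := inter i lt_im.
    by apply: inv_le => //; rewrite lam_lt1// i_gt0 (leq_trans lt_im).
  rewrite -natrB// mulrC mulr_natr -sumr_const_nat.
  apply: ler_sum_nat => i /andP[le_mi lt_in]; have /andP[lam_ge _] := lam_bound i lt_in.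
  have lam1 : lambda`_i < 1 by rewrite lam_lt1// lt_in andbT (leq_trans hm).
  by apply: le_trans (inv_le _ _ lam_ge lam1); rewrite opprK div1r.
(* Upper bound: here the unmatched terms are the first [n - m], of indices 1 to [n - m], bounded
   through [lambda]_1[; the index]n - m + i[is matched with]theta[_i]. *)
- have le1 : (1 <= n - m + 1)%N by rewrite addn1.
  have len : (n - m + 1 <= n)%N by lia.
  rewrite (big_cat_nat le1 len)/= addrC lerD//.
    rewrite addnC big_addn subKn//; apply: ler_sum_nat => i /andP[i_gt0 lt_im].
    have /andP[lam_th th_lam] := inter i lt_im; rewrite addnC.
    apply: inv_le => //; apply: le_lt_trans th_lam _.
    by rewrite lam_lt1// i_gt0 (leq_trans lt_im).
  rewrite -natrB// mulrC mulr_natr -{2}(addnK 1%N (n - m)%N) -sumr_const_nat.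
  apply: ler_sum_nat => i /andP[i_gt0 lt_i].
  have lt_in := leq_trans lt_i len.
  rewrite -[leRHS]div1r; apply: inv_le; last by rewrite lam_lt1.
  by rewrite (eigenvalues_nonincreasing hlambda)// i_gt0.
Qed.
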